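(* Let $I$ be an almost complete intersection monomial ideal of $R=K[x_1,\ldots,x_n]$ with $\operatorname{height}(I)=q\ge 2$, and let $I^p$ be the polarization of $I$, a squarefree monomial ideal. Consider the following possible forms of $I^p$, where in each form the monomials $u_1,u_2,\ldots,v_1,v_2,\ldots$ that appear are squarefree, different from $1$, and no two of them have a common factor, and where $r$ is an integer with $2\le r\le q$: (i) $I^p=(u_1v_1,u_2v_2,\ldots,u_rv_r,u_{r+1},\ldots,u_q,v_1v_2\cdots v_r)$; (ii) $I^p=(u_1v_1,u_2v_2,\ldots,u_rv_r,u_{r+1},\ldots,u_q,u_{q+1}v_1v_2\cdots v_r)$; (iii) $I^p=(v_1v_2,v_1v_3,v_2v_3,u_4,\ldots,u_{q+1})$; (iv) $I^p=(u_1v_1v_2,v_1v_3,v_2v_3,u_4,\ldots,u_{q+1})$; (v) $I^p=(u_1v_1v_2,u_2v_1v_3,v_2v_3,u_4,\ldots,u_{q+1})$; (vi) $I^p=(u_1v_1v_2,u_2v_1v_3,u_3v_2v_3,u_4,\ldots,u_{q+1})$. Then the following statements hold: (a) if $I^p$ has form (i), then $\beta_i(R/I)=\binom{q+1}{i}$ for $i=0,1,\ldots,r-1$ and $\beta_i(R/I)=\binom{q+1}{q+1-i}-\binom{q+1-r}{q+1-i}$ for $i=r,r+1,\ldots,q$; (b) if $I^p$ has form (ii) or (vi), then $\beta_i(R/I)=\binom{q+1}{i}$ for $i=0,1,\ldots,q$; (c) if $I^p$ has form (iii), (iv) or (v), then $\beta_i(R/I)=\binom{q+1}{i}-\binom{q-1}{i-2}$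 for $i=0,1,\ldots,q$.
   Context: $K$ is a field and $R=K[x_1,\ldots,x_n]$ is the polynomial ring. For a monomial ideal $I$ of $R$, $G(I)$ denotes its unique minimal set of monomial generators. $I$ is an almost complete intersection if $\operatorname{height}(I)=|G(I)|-1$. The polarization of a monomial $x_1^{a_1}\cdots x_n^{a_n}$ is the squarefree monomial $\prod_{i=1}^n\prod_{j=1}^{a_i}x_{i,j}$ in new variables $x_{i,j}$, and the polarization $I^p$ of $I$ is the ideal generated by the polarizations of the elements of $G(I)$ in a polynomial ring over $K$ in sufficiently many variables $x_{i,j}$. $\beta_i(R/I)$ denotes the $i$-th (total) Betti number, i.e. the rank of the $i$-th free module in the minimal graded free resolution of $R/I$ over $R$. Binomial coefficients $\binom{a}{b}$ with $b<0$ are $0$. Index ranges such as $u_{r+1},\ldots,u_q$ (when $r=q$) or $u_4,\ldots,u_{q+1}$ (when $q=2$) may be empty. *)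

(* Defs.v *)
From HB Require Import structures.
From mathcomp Require Import all_boot all_order all_algebra finmap.
From mathcomp.multinomials Require Import mpoly.
From mathcomp Require Import boolp.

Set Implicit Arguments.
Unset Strict Implicit.
Unset Printing Implicit Defensive.

Import GRing.Theory.
Local Open Scope ring_scope.

(* Ideals are [{pred R}], as in [ring_quotient]; classical logic ([asbool])
   makes the ideal generated by a set an element of [{pred R}]. *)

Definition ideal_gen (R : comNzRingType) (S : {pred R}) : {pred R} :=
  [pred p : R | `[< exists (k : nat) (c s : 'I_k -> R),
      (forall i, s i \in S) /\ p = \sum_(i < k) c i * s i >]].

(* In [ring_quotient], [idealr_closed] already requires [1 \notin P]. *)
Definition prime_ideal (R : comNzRingType) (P : {pred R}) : Prop :=
  idealr_closed P /\ prime_idealr_closed P.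

Definition proper_subset (T : Type) (A B : {pred T}) : Prop :=
  {subset A <= B} /\ ~ {subset B <= A}.

(* A chain P_0 < P_1 < ... < P_h = Q of prime ideals. *)
Definition prime_chain_to (R : comNzRingType) (Q : {pred R}) (h : nat) : Prop :=
  exists P : nat -> {pred R},
    [/\ forall i, (i <= h)%N -> prime_ideal (P i),
        forall i, (i < h)%N -> proper_subset (P i) (P i.+1)
      & P h =i Q].

Definition prime_height (R : comNzRingType) (Q : {pred R}) (h : nat) : Prop :=
  prime_chain_to Q h /\ forall k, prime_chain_to Q k -> (k <= h)%N.

(* Primes of infinite height satisfy no [prime_height Q h], hence do not
   constrain the minimum. *)
Definition height (R : comNzRingType) (I : {pred R}) (q : nat) : Prop :=
  (exists Q : {pred R},
     [/\ prime_ideal Q, {subset I <= Q} & prime_height Q q]) /\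
  (forall (Q : {pred R}) (h : nat),
     prime_ideal Q -> {subset I <= Q} -> prime_height Q h -> (q <= h)%N).

Section MonomialIdeals.
Variables (K : fieldType) (n : nat).
Local Notation R := {mpoly K[n]}.

Definition mon_ideal (A : {pred 'X_{1..n}}) : {pred R} :=
  ideal_gen [pred p : R | `[< exists2 m, m \in A & p = 'X_[m] >]].

Definition monomial_ideal (I : {pred R}) : Prop :=
  exists A : {pred 'X_{1..n}}, I =i mon_ideal A.

(* G = G(I): a set of monomials generating I, minimal for inclusion. *)
Definition min_mon_gens (I : {pred R}) (G : {fset 'X_{1..n}}) : Prop :=
  I =i mon_ideal (mem G) /\
  forall G' : {fset 'X_{1..n}},
    (G' `<=` G)%fset -> I =i mon_ideal (mem G') -> G' = G.

Definition almost_complete_intersection (I : {pred R}) : Prop :=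
  exists (G : {fset 'X_{1..n}}) (h : nat),
    [/\ min_mon_gens I G, height I h & h%:Z = #|` G|%:Z - 1].

End MonomialIdeals.

Arguments mon_ideal K {n} A.

(* The variable x_{i,j} of the polarization, for i < n and j < d, is the
   variable of index [mxvec_index i j] of {mpoly K[n * d]}.  This is the
   polarization of m as soon as all exponents of m are at most d. *)
Definition polarize_mon (n d : nat) (m : 'X_{1..n}) : 'X_{1..n * d} :=
  (\sum_(i < n) \sum_(j < d | (j < m i)%N) U_(mxvec_index i j))%MM.

(* The polarization of the monomial ideal whose minimal generators are G. *)
Definition polarization (K : fieldType) (n d : nat) (G : {fset 'X_{1..n}}) :
    {pred {mpoly K[n * d]}} :=
  mon_ideal K [pred m | `[< exists2 g, g \in G & m = polarize_mon d g >]].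

Arguments polarization K {n} d G.

Section Betti.
Variables (K : fieldType) (n : nat).
Local Notation R := {mpoly K[n]}.

Definition irrelevant_ideal : {pred R} :=
  ideal_gen [pred p : R | [exists k : 'I_n, p == 'X_k]].

(* Homogeneous of degree a; in negative degree only 0 is. *)
Definition zhomog (a : int) (p : R) : Prop :=
  p = 0 \/ exists2 d : nat, a = d%:Z & p \is d.-homog.

(* A sequence of graded free modules F_i = \bigoplus_j R(- gshift i j), whose
   elements are the row vectors of length [grank i], together with maps
   F_{i+1} -> F_i, v |-> v *m gdiff i, and F_0 -> R, v |-> v *m gaug, the latter
   representing the augmentation F_0 -> R / I. *)
Record graded_free_seq := GradedFreeSeq {
  grank : nat -> nat;
  gshift : forall i, 'I_(grank i) -> int;
  gdiff : forall i, 'M[R]_(grank i.+1, grank i);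
  gaug : 'cV[R]_(grank 0)
}.

Definition graded_maps (F : graded_free_seq) : Prop :=
  (forall i j k, zhomog (@gshift F i.+1 j - @gshift F i k) (gdiff F i j k)) /\
  (forall j, zhomog (@gshift F 0 j) (gaug F j ord0)).

(* Exactness of ... -> F_1 -> F_0 -> R / I -> 0. *)
Definition free_resolution (I : {pred R}) (F : graded_free_seq) : Prop :=
  [/\ forall p : R, exists v : 'rV_(grank F 0),
        (v *m gaug F) ord0 ord0 - p \in I,
      forall v : 'rV_(grank F 0),
        (v *m gaug F) ord0 ord0 \in I <-> exists w, v = w *m gdiff F 0
    & forall i (v : 'rV_(grank F i.+1)),
        v *m gdiff F i = 0 <-> exists w, v = w *m gdiff F i.+1].

Definition minimal_graded_resolution (I : {pred R}) (F : graded_free_seq) :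
    Prop :=
  [/\ graded_maps F, free_resolution I F
    & forall i j k, gdiff F i j k \in irrelevant_ideal].

(* beta_i(R / I); the value 0 is a default when no resolution exists. *)
Definition betti (I : {pred R}) (i : nat) : nat :=
  if pselect (exists F, minimal_graded_resolution I F) is left exF
  then grank (projT1 (cid exF)) i else 0%N.

End Betti.

(* Binomial coefficients that vanish for a negative lower index. *)
Definition binz (a : nat) (b : int) : int :=
  if b is Posz k then 'C(a, k)%:Z else 0.

Section Forms.
Local Open Scope nat_scope.
Variables (K : fieldType) (N : nat).
Local Notation mon := 'X_{1..N}.
Implicit Types (J : {pred {mpoly K[N]}}) (u v : nat -> mon) (s : seq mon).

(* Monomials are exponent vectors: [0%MM] is the monomial 1 and [+] is the
   product of monomials. *)

Definition squarefree_mon (m : mon) : bool := [forall i, m i <= 1]%N.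

Definition coprime_mon (m m' : mon) : bool :=
  [forall i, (m i == 0%N) || (m' i == 0%N)].

Definition admissible s : bool :=
  [&& all squarefree_mon s, all (fun m => m != 0%MM) s
    & pairwise coprime_mon s].

(* u_a, ..., u_b *)
Definition mons u (a b : nat) : seq mon := [seq u i | i <- index_iota a b.+1].

Definition form1 (q r : nat) J : Prop :=
  exists u v,
    admissible (mons u 1 q ++ mons v 1 r) /\
    J =i mon_ideal K (mem ([seq (u i + v i)%MM | i <- index_iota 1 r.+1]
                       ++ mons u r.+1 q
                       ++ [:: (\sum_(1 <= i < r.+1) v i)%MM])).

Definition form2 (q r : nat) J : Prop :=
  exists u v,
    admissible (mons u 1 q.+1 ++ mons v 1 r) /\
    J =i mon_ideal K (mem ([seq (u i + v i)%MM | i <- index_iota 1 r.+1]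
                       ++ mons u r.+1 q
                       ++ [:: (u q.+1 + \sum_(1 <= i < r.+1) v i)%MM])).

Definition form3 (q : nat) J : Prop :=
  exists u v,
    admissible (mons u 4 q.+1 ++ mons v 1 3) /\
    J =i mon_ideal K (mem ([:: v 1 + v 2; v 1 + v 3; v 2 + v 3]%MM
                       ++ mons u 4 q.+1)).

Definition form4 (q : nat) J : Prop :=
  exists u v,
    admissible (mons u 1 1 ++ mons u 4 q.+1 ++ mons v 1 3) /\
    J =i mon_ideal K (mem ([:: u 1 + v 1 + v 2; v 1 + v 3; v 2 + v 3]%MM
                       ++ mons u 4 q.+1)).

Definition form5 (q : nat) J : Prop :=
  exists u v,
    admissible (mons u 1 2 ++ mons u 4 q.+1 ++ mons v 1 3) /\
    J =i mon_ideal K (mem ([:: u 1 + v 1 + v 2; u 2 + v 1 + v 3; v 2 + v 3]%MM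
                       ++ mons u 4 q.+1)).

Definition form6 (q : nat) J : Prop :=
  exists u v,
    admissible (mons u 1 q.+1 ++ mons v 1 3) /\
    J =i mon_ideal K (mem ([:: u 1 + v 1 + v 2; u 2 + v 1 + v 3;
                              u 3 + v 2 + v 3]%MM
                       ++ mons u 4 q.+1)).

End Forms.

(* Main.v *)
Require Import Defs.
From HB Require Import structures.
From mathcomp Require Import all_boot all_order all_algebra finmap.
From mathcomp.multinomials Require Import mpoly.
From mathcomp Require Import boolp.

Set Implicit Arguments.
Unset Strict Implicit.
Unset Printing Implicit Defensive.

Import GRing.Theory.
Local Open Scope ring_scope.

(** A graded resolution that is minimal determines the Betti numbers, so it
suffices to exhibit one minimal resolution for each form.  All of them are
subcomplexes of the Taylor complex.

Let $m_x$, for $x$ in a finite set $X$, be the minimal generators of $I$.  A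
simplicial complex $D$ on $X$ spans a subcomplex of the Taylor complex, with a
basis element of degree $lcm(m_x : x \in A)$ for every face $A$.  In multidegree
$a$ it is the simplicial chain complex over $K$ of the faces contained in
$V_a = \{x : m_x | a\}$, hence it is a resolution as soon as these complexes are
cones for all nonempty $V_a$ ([bd_exact]), and it is minimal when no generator
of a face divides the lcm of the other ones ([betti_simplicial]).  Both
conditions only concern divisibility among generators and lcms, which
polarization reflects: they can be read off the generators of $I^p$
([polarization_gens], [betti_blocks]).

In the six forms the generators of $I^p$ are products of pairwise coprime
blocks $u_i$, $v_j$, so all that matters is which blocks occur in which
generator.
- In (ii) and (vi) every generator has a block of its own; the full simplex, that
  is the Taylor complex, is already minimal ([betti_private_blocks]).
- In the other forms there are a set $S$ of generators and a generator $w$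
  outside of $S$ that divides the lcm of $S$: the $u_iv_i$ and $v_1...v_r$ in (i),
  the first two generators and the third one in (iii), (iv), (v).  The faces
  not containing $S$ form a complex which is still a cone in each multidegree: if
  $V_a$ contains $S$ then it contains $w$, which is a cone point, and otherwise
  all subsets of $V_a$ are faces.  The resolution on this complex is minimal
  ([betti_redundant_block]).  Compared with the Taylor complex, homological degree
  $i$ loses the sets of size $i$ that contain $S$, and there are
  $\binom{q+1-|S|}{i-|S|}$ of these; $|S| = r$ in (i) and $|S| = 2$ in the others.

The uniqueness of the ranks is the comparison theorem: between two resolutions
there are chain maps whose composite is homotopic to the identity, and after
setting all variables to zero a homotopy vanishes if the differentials are
minimal ([grank_le]). *)

(** * Uniqueness of the ranks of a minimal resolution *)

Section RanksOfMinimalResolutions.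
Variables (K : fieldType) (n : nat).
Local Notation R := {mpoly K[n]}.
Implicit Types (I : {pred R}) (F : graded_free_seq K n).

Lemma ideal_gen_closed (S : {pred R}) :
  [/\ 0 \in ideal_gen S,
      forall p q : R, p \in ideal_gen S -> q \in ideal_gen S ->
        p + q \in ideal_gen S
    & forall a p : R, p \in ideal_gen S -> a * p \in ideal_gen S].
Proof.
split.
- apply/asboolP; exists 0%N, (fun=> 0), (fun=> 0).
  by split=> [[]//|]; rewrite big_ord0.
- move=> p q /asboolP[k [c [s [sS ->]]]] /asboolP[l [c' [s' [sS' ->]]]].
  apply/asboolP; exists (k + l)%N.
  exists (fun i => match split i with inl j => c j | inr j => c' j end).
  exists (fun i => match split i with inl j => s j | inr j => s' j end).
  split=> [i|]; first by case: split.
  rewrite big_split_ord /=; congr (_ + _); apply: eq_bigr => i _.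
  + by case: split_ordP => j; [move/lshift_inj-> | move/eqP; rewrite eq_lrshift].
  + by case: split_ordP => j; [move/eqP; rewrite eq_rlshift | move/rshift_inj->].
move=> a p /asboolP[k [c [s [sS ->]]]]; apply/asboolP.
exists k, (fun i => a * c i), s; split=> //.
by rewrite mulr_sumr; apply: eq_bigr => i _; rewrite mulrA.
Qed.

Lemma ideal_gen_sum (S : {pred R}) J (r : seq J) (P : pred J) (f : J -> R) :
  (forall j, P j -> f j \in ideal_gen S) ->
  \sum_(j <- r | P j) f j \in ideal_gen S.
Proof.
move=> fS; have [S0 SD _] := ideal_gen_closed S.
by elim/big_ind: _ => // *; apply: SD.
Qed.

Lemma mulmx_ideal_gen (S : {pred R}) r (v : 'rV[R]_r) (e : 'cV[R]_r) :
  (forall j, e j ord0 \in ideal_gen S) -> (v *m e) ord0 ord0 \in ideal_gen S.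
Proof.
have [_ _ SM] := ideal_gen_closed S.
by move=> eS; rewrite mxE; apply: ideal_gen_sum => j _; apply: SM.
Qed.

(** Treating $I$ as the target of the augmentation on an equal footing with the
kernels of the differentials gives exactness, and later the lifting arguments,
a form that is the same in degree 0 and in positive degrees. *)
Definition syzygy I F (i : nat) : 'rV[R]_(grank F i) -> Prop :=
  match i with
  | 0 => fun v => (v *m gaug F) ord0 ord0 \in I
  | i'.+1 => fun v => v *m gdiff F i' = 0
  end.

Lemma syzygyP I F i v :
  free_resolution I F -> syzygy I v <-> exists w, v = w *m gdiff F i.
Proof. by case=> _ F0 F1; case: i v => [|i] v /=; [apply: F0|apply: F1]. Qed.

Lemma lift_syzygy I F i k (M : 'M[R]_(k, grank F i)) :
  free_resolution I F -> (forall j, syzygy I (row j M)) ->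
  exists N, M = N *m gdiff F i.
Proof.
move=> resF MI; have /choice[N NM] j := (syzygyP (row j M) resF).1 (MI j).
exists (\matrix_j N j); apply/row_matrixP => j.
by rewrite row_mul rowK.
Qed.

Lemma syzygy_row_gdiff I F i j :
  free_resolution I F -> syzygy I (row j (gdiff F i)).
Proof.
move=> resF; apply/(syzygyP _ resF).
by exists (delta_mx 0 j); rewrite -rowE.
Qed.

Definition maps_syzygies I F F' i (f : 'M[R]_(grank F i, grank F' i)) :=
  forall v, syzygy I v -> syzygy I (v *m f).

(** One step of the comparison theorem.  As [f'] is again compatible with the
syzygies, the step can be iterated without keeping the previous maps. *)
Lemma lift_maps_syzygies I F F' i (f : 'M[R]_(grank F i, grank F' i)) :
  free_resolution I F -> free_resolution I F' -> maps_syzygies I f ->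
  exists2 f' : 'M[R]_(grank F i.+1, grank F' i.+1),
    gdiff F i *m f = f' *m gdiff F' i & maps_syzygies I f'.
Proof.
move=> resF resF' fP.
have [j|f' f'P] := @lift_syzygy I F' i _ (gdiff F i *m f) resF'.
  by rewrite row_mul; apply/fP/syzygy_row_gdiff.
by exists f' => // v /= v0; rewrite -mulmxA -f'P mulmxA v0 mul0mx.
Qed.

(** The start of the comparison theorem: [f] lifts the identity of $R/I$. *)
Lemma lift_maps_syzygies0 (S : {pred R}) F F' (I := ideal_gen S) :
  free_resolution I F -> free_resolution I F' ->
  exists f : 'M[R]_(grank F 0, grank F' 0),
    (forall v : 'rV_(grank F 0), (v *m (f *m gaug F' - gaug F)) ord0 ord0 \in I)
    /\ maps_syzygies I f.
Proof.
move=> resF [F'0 _ _].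
have [_ ID IM] := ideal_gen_closed S.
have /choice[f fP] (j : 'I_(grank F 0)) := F'0 (gaug F j ord0).
have fgI (v : 'rV_(grank F 0)) :
    (v *m ((\matrix_j f j) *m gaug F' - gaug F)) ord0 ord0 \in I.
  apply: (@mulmx_ideal_gen S) => j; rewrite -/I.
  have -> : ((\matrix_j f j) *m gaug F' - gaug F) j ord0
      = (f j *m gaug F') ord0 ord0 - gaug F j ord0.
    by rewrite !mxE; congr (_ - _); apply: eq_bigr => k _; rewrite mxE.
  exact: fP.
exists (\matrix_j f j); split=> // v /= vI.
have -> : v *m (\matrix_j f j) *m gaug F'
    = v *m ((\matrix_j f j) *m gaug F' - gaug F) + v *m gaug F.
  by rewrite mulmxBr mulmxA subrK.
by rewrite mxE; apply: ID.
Qed.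

Local Notation cst := (map_mx (meval (fun _ : 'I_n => (0 : K)))).

Lemma meval0_irrelevant (p : R) :
  p \in @irrelevant_ideal K n -> meval (fun=> 0) p = 0.
Proof.
case/asboolP=> k [c [s [sX ->]]]; rewrite rmorph_sum big1 //= => i _.
have /existsP[j /eqP->] := sX i.
by rewrite mevalM mevalXU mulr0.
Qed.

(** The chain maps [f], [g] and the homotopy [h] are built simultaneously, one
degree at a time.  Of the homotopy it is enough to remember that $fg - 1 - hd$
kills the syzygies, because this lets the next [h] be lifted.  Minimality
makes the constant terms of $fg$ and of $1$ agree, so that the rank of [F] is at
most that of [F']. *)
Lemma grank_le (S : {pred R}) F F' i (I := ideal_gen S) :
  minimal_graded_resolution I F -> free_resolution I F' ->
  (grank F i <= grank F' i)%N.
Proof.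
move=> [_ resF minF] resF'.
have cst_gdiff j : cst (gdiff F j) = 0.
  by apply/matrixP => a b; rewrite !mxE meval0_irrelevant.
suff [f [g [h [_ _ _ fg1]]]] :
    exists f g (h : 'M_(grank F i, grank F i.+1)),
      [/\ @maps_syzygies I F F' i f, @maps_syzygies I F' F i g,
          forall v, syzygy I v -> v *m (f *m g - 1%:M - h *m gdiff F i) = 0
        & cst (f *m g) = 1%:M].
  by apply: (@mulmx1_min _ _ _ (cst f) (cst g)); rewrite -map_mxM.
elim: i => [|i [f [g [h [fS gS hS fg1]]]]].
  have [f [fI fS]] := lift_maps_syzygies0 resF resF'.
  have [g [gI gS]] := lift_maps_syzygies0 resF' resF.
  have [j|h hP] := @lift_syzygy I F 0 _ (f *m g - 1%:M) resF.
    have [_ ID _] := ideal_gen_closed S.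
    rewrite /= -row_mul rowE.
    have -> : (f *m g - 1%:M) *m gaug F
        = f *m (g *m gaug F - gaug F') + (f *m gaug F' - gaug F).
      by rewrite mulmxBl mulmxBr mul1mx mulmxA addrA subrK.
    by rewrite mulmxDr mulmxA mxE; apply: ID.
  exists f, g, h; split=> // [v _|]; first by rewrite hP subrr mulmx0.
  have : cst (f *m g - 1%:M) = 0 by rewrite hP map_mxM cst_gdiff mulmx0.
  by rewrite map_mxB map_mx1 => /eqP; rewrite subr_eq0 => /eqP.
have [f' ff' f'S] := lift_maps_syzygies resF resF' fS.
have [g' gg' g'S] := lift_maps_syzygies resF' resF gS.
have dfg : gdiff F i *m (f *m g - 1%:M)
    = (f' *m g' - 1%:M) *m gdiff F i.
  rewrite mulmxBr mulmx1 mulmxBl mul1mx; congr (_ - _).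
  by rewrite mulmxA ff' -!mulmxA gg'.
have dfh : gdiff F i *m (f *m g - 1%:M - h *m gdiff F i) = 0.
  apply/row_matrixP => j; rewrite row_mul row0.
  exact/hS/syzygy_row_gdiff.
have [j|h' h'P] :=
    @lift_syzygy I F i.+1 _ (f' *m g' - 1%:M - gdiff F i *m h) resF.
  rewrite /= -row_mul mulmxBl -dfg -mulmxA -mulmxBr dfh.
  exact: row0.
exists f', g', h'; split=> // [v /= vS|].
  have -> : f' *m g' - 1%:M - h' *m gdiff F i.+1 = gdiff F i *m h.
    by rewrite -h'P opprB addrC subrK.
  by rewrite mulmxA vS mul0mx.
have : cst (f' *m g' - 1%:M - gdiff F i *m h) = 0.
  by rewrite h'P map_mxM cst_gdiff mulmx0.
rewrite !map_mxB [cst (_ *m h)]map_mxM cst_gdiff mul0mx subr0 map_mx1.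
by move/eqP; rewrite subr_eq0 => /eqP.
Qed.

Lemma free_resolution_eqi I J F :
  I =i J -> free_resolution I F -> free_resolution J F.
Proof.
move=> IJ [F0 F1 F2]; split=> // [p|v].
  by have [v vI] := F0 p; exists v; rewrite -IJ.
by rewrite -IJ.
Qed.

Lemma betti_eq (S : {pred R}) I F i :
  I =i ideal_gen S -> minimal_graded_resolution I F -> betti I i = grank F i.
Proof.
move=> IS mF; rewrite /betti; case: pselect => [exF|[]]; last by exists F.
case: cid => F' mF' /=.
have toS E : minimal_graded_resolution I E ->
    minimal_graded_resolution (ideal_gen S) E.
  by case=> *; split=> //; apply: free_resolution_eqi IS _.
have [mFS mFS'] := (toS _ mF, toS _ mF').
apply/eqP; rewrite eqn_leq.
by rewrite (grank_le i mFS') ?(grank_le i mFS) //; [case: mFS'|case: mFS].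
Qed.

End RanksOfMinimalResolutions.

(** * Resolutions supported on a simplicial complex *)

Section Multidegrees.
Variables (n s : nat) (g : 'I_s -> 'X_{1..n}).
Implicit Types (A B : {set 'I_s}).

Definition mlcms A : 'X_{1..n} := [multinom \max_(x in A) g x i | i < n].

Lemma mlcms_leP A (a : 'X_{1..n}) :
  reflect (forall x, x \in A -> (g x <= a)%MM) (mlcms A <= a)%MM.
Proof.
apply: (iffP mnm_lepP) => [le x xA|le i]; last first.
  by rewrite mnmE; apply/bigmax_leqP => x xA; apply/mnm_lepP/le.
apply/mnm_lepP => i; apply: leq_trans (le i).
by rewrite mnmE (bigmax_sup x).
Qed.

Lemma mlcmsS A B : A \subset B -> (mlcms A <= mlcms B)%MM.
Proof.
move/subsetP => AB; apply/mlcms_leP => x /AB xB.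
by apply/mnm_lepP => i; rewrite mnmE (bigmax_sup x).
Qed.

Lemma mlcms0 : mlcms set0 = 0%MM.
Proof. by apply/mnmP => i; rewrite !mnmE big_set0. Qed.

Lemma mlcmsU x A (a : 'X_{1..n}) :
  (mlcms (x |: A) <= a)%MM = (g x <= a)%MM && (mlcms A <= a)%MM.
Proof.
apply/mlcms_leP/andP => [le|[xa /mlcms_leP le] y]; last first.
  by rewrite !inE => /predU1P[->//|/le].
split; first by apply: le; rewrite setU11.
by apply/mlcms_leP => y yA; apply: le; rewrite setU1r.
Qed.

End Multidegrees.

Section IncidenceSigns.
Variables (s : nat) (K : comNzRingType).
Implicit Types (x c : 'I_s) (B : {set 'I_s}).

Definition sgn x B : K := (-1) ^+ #|[set y in B | (y < x)%N]|.

Lemma sgn_sq x B : sgn x B * sgn x B = 1.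
Proof. by rewrite -expr2 sqrr_sign. Qed.

Lemma sgnU x c B : c \notin B -> sgn x (c |: B) = (-1) ^+ (c < x)%N * sgn x B.
Proof.
move=> cB; rewrite /sgn -exprD; congr (_ ^+ _).
have [cx|xc] := ltnP c x.
  have -> : [set y in c |: B | (y < x)%N] = c |: [set y in B | (y < x)%N].
    by apply/setP => y; rewrite !inE; case: (eqVneq y c) => [->|].
  by rewrite cardsU1 inE (negbTE cB).
apply: eq_card => y; rewrite !inE; case: (eqVneq y c) => [->|//].
by rewrite ltnNge xc !andbF.
Qed.

(** Adding the vertex [x] to the cone over [B] and coning the face [x |: B] compare
with opposite signs, so that the two contributions cancel in [cone_contraction];
[sgn_anticomm] is the rule that makes the boundary square to 0. *)
Lemma sgn_swap x c B : x != c -> x \notin B -> c \notin B ->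
  sgn x (c |: B) * sgn c (x |: B) = - (sgn c B * sgn x B).
Proof.
move=> xc xB cB; rewrite !sgnU // mulrACA -exprD [sgn x B * _]mulrC.
have -> : ((c < x)%N + (x < c)%N)%N = 1%N.
  by rewrite -(inj_eq val_inj) /= in xc; case: ltngtP xc.
by rewrite expr1 mulN1r.
Qed.

Lemma sgn_anticomm x y B : x != y -> x \notin B -> y \notin B ->
  sgn x (y |: B) * sgn y B = - (sgn y (x |: B) * sgn x B).
Proof.
move=> xy xB yB; rewrite !sgnU // -!mulrA [sgn y B * _]mulrC -mulNr.
congr (_ * _); rewrite -(inj_eq val_inj) /= in xy.
by case: ltngtP xy => // _ _; rewrite ?opprK.
Qed.

End IncidenceSigns.

Section SimplicialResolution.
Variables (K : fieldType) (n s : nat) (g : 'I_s -> 'X_{1..n}).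
Variable D : {set {set 'I_s}}.
Local Notation R := {mpoly K[n]}.
Local Notation lcm := (mlcms g).
Local Notation sg := (@sgn s K).
Implicit Types (A B C : {set 'I_s}) (x c : 'I_s) (v w : {set 'I_s} -> R).

Hypothesis D_down : forall A B, A \subset B -> B \in D -> A \in D.

Lemma mcoeffMX_if (p : R) (k m : 'X_{1..n}) :
  (p * 'X_[k])@_m = if (k <= m)%MM then p@_(m - k) else 0.
Proof.
case: ifP => km; first by rewrite -[in LHS](submK km) addmC mcoeffMX.
apply: memN_msupp_eq0; rewrite (perm_mem (msuppMX p k)).
by apply/negP => /mapP[m' _ mE]; rewrite mE lem_addr in km.
Qed.

Definition bd v B : R :=
  \sum_(x | (x \notin B) && (x |: B \in D))
    sg x B *: (v (x |: B) * 'X_[lcm (x |: B) - lcm B]).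

(** The component of [v] in multidegree [a], a chain over the field: the
coefficient of the face [A] is that of the monomial of degree $a - lcm(A)$. *)
Definition slice v (a : 'X_{1..n}) A : K :=
  if (lcm A <= a)%MM then (v A)@_(a - lcm A) else 0.

(** In each multidegree the boundary is the simplicial one. *)
Lemma bd_slice v (a : 'X_{1..n}) B : (lcm B <= a)%MM ->
  (bd v B)@_(a - lcm B)
  = \sum_(x | (x \notin B) && (x |: B \in D)) sg x B * slice v a (x |: B).
Proof.
move=> Ba; rewrite raddf_sum; apply: eq_bigr => x _ /=.
rewrite mcoeffZ mcoeffMX_if /slice; congr (_ * _).
have BxB : (lcm B <= lcm (x |: B))%MM by apply/mlcmsS/subsetUr.
have -> : (lcm (x |: B) - lcm B <= a - lcm B)%MM = (lcm (x |: B) <= a)%MM.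
  apply/mnm_lepP/mnm_lepP => le i; move: (le i); rewrite !mnmBE.
    by rewrite leq_sub2rE //; apply/mnm_lepP.
  by apply: leq_sub2r.
case: ifP => // xBa; congr _@__; apply/mnmP => i; rewrite !mnmBE.
by rewrite -subnDA subnKC //; apply/mnm_lepP.
Qed.

(** The cone $c * f$ bounds $f$ if $f$ is a cycle.  A face avoiding [c] is only hit
from its cone, and on a face containing [c] the terms of the boundary cancel by
the cycle condition on the opposite face. *)
Lemma cone_contraction c (f : {set 'I_s} -> K) B :
  (forall A, f A != 0 -> A \in D -> c |: A \in D) ->
  (c \in B -> \sum_(x | (x \notin B :\ c) && (x |: (B :\ c) \in D))
                sg x (B :\ c) * f (x |: (B :\ c)) = 0) ->
  B \in D ->
  \sum_(x | (x \notin B) && (x |: B \in D)) sg x B *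
    (if c \in x |: B then sg c ((x |: B) :\ c) * f ((x |: B) :\ c) else 0)
  = f B.
Proof.
move=> fcone fcyc BD; have [cB|cB] := boolP (c \in B); last first.
  rewrite big_mkcond (bigD1 c) //= cB setU11 setU1K //= big1 => [|x xc].
    rewrite addr0; case: ifPn => [_|cBD]; first by rewrite mulrA sgn_sq mul1r.
    by apply/esym/eqP; apply: contraNT cBD => fB; apply: fcone.
  by case: ifP => // _; rewrite !inE eq_sym (negbTE xc) (negbTE cB) mulr0.
have {fcyc} := fcyc cB; rewrite (bigD1 c) /=; last by rewrite setD11 setD1K.
rewrite setD1K // => /eqP; rewrite addrC addr_eq0 => /eqP cyc.
have -> : f B = sg c (B :\ c) * (sg c (B :\ c) * f B).
  by rewrite mulrA sgn_sq mul1r.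
rewrite -[sg c _ * f B]opprK -cyc mulrN -mulNr mulr_sumr.
rewrite big_mkcond [RHS]big_mkcond; apply: eq_bigr => x _.
rewrite setU1r // !inE; have [-> | xc] := eqVneq x c; first by rewrite cB andbF.
rewrite andbT /=; have [//|xB] := boolP (x \in B).
have xBc : x \notin B :\ c by rewrite !inE negb_and xB orbT.
have cE : c |: (x |: (B :\ c)) = x |: B by rewrite setUCA setD1K.
have -> : (x |: B) :\ c = x |: (B :\ c).
  by rewrite -cE setU1K // !inE eq_sym negb_or xc eqxx.
have [->|fx] := eqVneq (f (x |: (B :\ c))) 0.
  by rewrite !mulr0; do 2!case: ifP.
have -> : (x |: B \in D) = (x |: (B :\ c) \in D).
  apply/idP/idP => [|/(fcone _ fx)]; last by rewrite cE.
  by apply: D_down; rewrite -cE subsetUr.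
case: ifP => //= _; rewrite !mulrA -[in sg x B](setD1K cB).
by rewrite sgn_swap // ?setD11 // mulNr.
Qed.

(** When no generator divides [a], the point [c] is arbitrary. *)
Definition has_cone_points := forall a : 'X_{1..n}, exists c,
  (exists x, (g x <= a)%MM) ->
  (g c <= a)%MM /\ (forall A, (lcm A <= a)%MM -> A \in D -> c |: A \in D).

(** The slices of a cycle [v] are coned off one multidegree at a time; their sum
is a polynomial because the cone operation does not increase the degree of the
coefficients.  The condition on the supports provides cone points; for [l > 0]
it holds because faces are nonempty, for [l = 0] it says that the coefficient of
the empty face lies in the ideal. *)
Lemma bd_exact (v : {set 'I_s} -> R) (l : nat) : has_cone_points ->
  (forall B, B \in D -> #|B|.+1 = l -> bd v B = 0) ->
  (forall B m, B \in D -> #|B| = l -> m \in msupp (v B) ->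
     exists x, (g x <= m + lcm B)%MM) ->
  exists w, forall B, B \in D -> #|B| = l -> bd w B = v B.
Proof.
move=> /choice[c cP] vcyc vsupp.
pose k := \max_A msize (v A).
pose f B (m : 'X_{1..n}) : K := let a := (m + lcm B)%MM in
  if c a \in B then sg (c a) (B :\ c a) * slice v a (B :\ c a) else 0.
pose w B : R := \sum_(m : 'X_{1..n < k}) f B m *: 'X_[m].
have w_coeff B m : (w B)@_m = f B m.
  have [mk|km] := ltnP (mdeg m) k; first by rewrite /w mcoeff_mpoly.
  rewrite /w raddf_sum big1 => [|m' _] /=; last first.
    rewrite mcoeffZ mcoeffX; case: eqP => [mE|_]; last by rewrite mulr0.
    by move: km; rewrite -mE leqNgt bmdeg.
  rewrite /f; case: ifP => //= _; rewrite /slice; case: ifP; rewrite ?mulr0//.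
  set B' := _ :\ _ => _; rewrite memN_msupp_eq0 ?mulr0 // msize_mdeg_ge //.
  have vB'k : (msize (v B') <= k)%N.
    by apply: (leq_bigmax (F := fun A => msize (v A))).
  apply: leq_trans vB'k (leq_trans km _).
  rewrite -addmBA ?mdegD ?leq_addr //; exact/mlcmsS/subsetDl.
exists w => B BD Bl; apply/mpolyP => m.
pose a := (m + lcm B)%MM.
have Ba : (lcm B <= a)%MM by rewrite lem_addl.
have -> : m = (a - lcm B)%MM by rewrite addmK.
rewrite bd_slice //.
have w_slice A : slice w a A =
    if (lcm A <= a)%MM then
      if c a \in A then sg (c a) (A :\ c a) * slice v a (A :\ c a) else 0
    else 0.
  rewrite {1}/slice; case: ifP => // Aa.
  by rewrite w_coeff /f submK.
have [[x xa]|Va0] := pselect (exists x, (g x <= a)%MM); last first.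
  rewrite big1 => [|x _].
    apply/esym/memN_msupp_eq0/negP => /(vsupp _ _ BD Bl) [x].
    by rewrite submK // => xa; apply: Va0; exists x.
  rewrite w_slice mlcmsU; case: ifP; rewrite ?mulr0 // => /andP[xa _].
  by case: Va0; exists x.
have [ca ccone] := cP a (ex_intro _ x xa).
have -> : (v B)@_(a - lcm B) = slice v a B by rewrite /slice Ba.
(* A face outside of $V_a$ stays outside when the apex [c a] is removed; its slice
   vanishes, so that the truncation in [w_slice] is invisible. *)
rewrite -(@cone_contraction (c a)) //.
- apply: eq_bigr => y _; rewrite w_slice; case: ifP => // yBa.
  case: ifP => // cyB; suff -> : slice v a ((y |: B) :\ c a) = 0.
    by rewrite !mulr0.
  rewrite /slice ifF //; apply: contraFF yBa => le.
  by rewrite -(setD1K cyB) mlcmsU ca.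
- move=> A; rewrite /slice; case: ifP; rewrite ?eqxx // => Aa _.
  exact: ccone.
move=> cB; rewrite -bd_slice; last first.
  exact: lepm_trans (mlcmsS _ (subsetDl _ _)) Ba.
rewrite vcyc ?mcoeff0 //; first exact: D_down (subsetDl _ _) BD.
by rewrite -Bl (cardsD1 (c a) B) cB.
Qed.

Lemma bd_bd v B : bd (bd v) B = 0.
Proof.
rewrite /bd.
pose F x y : R := if [&& y \notin B, x \notin y |: B & x |: (y |: B) \in D]
  then sg x (y |: B) * sg y B *:
    (v (x |: (y |: B)) * 'X_[lcm (x |: (y |: B)) - lcm B]) else 0.
transitivity (\sum_y \sum_x F x y).
  rewrite big_mkcond; apply: eq_bigr => y _; case: ifP => [/andP[yB yD]|yBD].
    rewrite mulr_suml scaler_sumr big_mkcond; apply: eq_bigr => x _.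
    rewrite /F yB /=; case: ifP => // _.
    rewrite -scalerAl scalerA mulrC -mulrA -mpolyXD; congr (_ *: (_ * 'X_[_])).
    rewrite addmBA; last exact/mlcmsS/subsetUr.
    by rewrite submK //; apply/mlcmsS/subsetUr.
  rewrite big1 // => x _; rewrite /F; case: ifP => // /and3P[yB xyB xyD].
  by move: yBD; rewrite yB (D_down _ xyD) // subsetUr.
have FN x y : x != y -> F x y = - F y x.
  move=> xy; rewrite /F; rewrite !inE !negb_or xy eq_sym xy /=.
  rewrite setUCA; have [xB|] := boolP (x \in B); rewrite ?andbF ?oppr0 //=.
  have [yB|] := boolP (y \in B); rewrite ?andbF ?oppr0 //= => yB xB.
  by case: ifP; rewrite ?oppr0 // sgn_anticomm // scaleNr.
have F0 x : F x x = 0 by rewrite /F setU11 andbF.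
(* Pairing the two orders in which [x] and [y] are removed avoids dividing by 2. *)
have split_lt y : \sum_x F x y
    = \sum_(x : 'I_s | (x < y)%N) F x y
      + \sum_(x : 'I_s | (y < x)%N) F x y.
  rewrite (bigID (fun x : 'I_s => (x < y)%N)) /=; congr (_ + _).
  rewrite (bigD1 y) ?ltnn //= F0 add0r; apply: eq_bigl => x.
  by rewrite -leqNgt ltn_neqAle andbC eq_sym.
rewrite (eq_bigr _ (fun y _ => split_lt y)) big_split /=.
rewrite [X in _ + X](exchange_big_dep predT) //= -big_split /= big1 // => y _.
rewrite -big_split /= big1 // => x xy; rewrite FN ?addNr //.
by rewrite -(inj_eq val_inj) /= neq_ltn xy.
Qed.

End SimplicialResolution.

Section SimplicialResolutionIsMinimal.
Variables (K : fieldType) (n s : nat) (g : 'I_s -> 'X_{1..n}).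
Variable D : {set {set 'I_s}}.
Local Notation R := {mpoly K[n]}.
Local Notation lcm := (mlcms g).
Implicit Types (A B : {set 'I_s}) (x : 'I_s) (w : {set 'I_s} -> R).

Hypothesis D_down : forall A B, A \subset B -> B \in D -> A \in D.
Hypothesis D0 : set0 \in D.
Hypothesis D_cone : has_cone_points g D.
Hypothesis D_min : forall A x, A \in D -> x \in A -> ~~ (g x <= lcm (A :\ x))%MM.

Variable I : {pred R}.
Hypothesis IP : forall p : R,
  p \in I <-> forall m, m \in msupp p -> exists x, (g x <= m)%MM.

Definition cells (i : nat) := [set A in D | #|A| == i].

Lemma cellsP i (j : 'I_#|cells i|) :
  enum_val j \in D /\ #|(enum_val j : {set 'I_s})| = i.
Proof. by have := enum_valP j; rewrite inE => /andP[-> /eqP]. Qed.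

Definition incidence A B : R :=
  \sum_(x | (x \notin B) && (A == x |: B)) sgn K x B *: 'X_[lcm A - lcm B].

Definition simplicial_seq : graded_free_seq K n :=
  @GradedFreeSeq K n (fun i => #|cells i|)
    (fun i j => (mdeg (lcm (enum_val j)))%:Z)
    (fun i => \matrix_(j, k) incidence (enum_val j) (enum_val k))
    (const_mx 1).

(** Chains are manipulated as functions on all sets; [chain] and [chain_coef]
translate from and to row vectors indexed by the faces with [i] elements. *)
Definition chain i w : 'rV[R]_#|cells i| := \row_j w (enum_val j).

Definition chain_coef i (v : 'rV[R]_#|cells i|) A : R :=
  \sum_j v ord0 j *+ (enum_val j == A).

Lemma chain_coefK i (v : 'rV[R]_#|cells i|) : chain i (chain_coef v) = v.
Proof.
apply/rowP => j; rewrite mxE /chain_coef (bigD1 j) //= eqxx mulr1n.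
rewrite big1 ?addr0 // => k kj.
by rewrite (inj_eq enum_val_inj) (negbTE kj) mulr0n.
Qed.

Lemma chain_gdiff i w :
  chain i.+1 w *m gdiff simplicial_seq i = chain i (bd g D w).
Proof.
apply/rowP => k; rewrite !mxE.
have [BD Bi] := cellsP k; set B := enum_val k in BD Bi *.
rewrite -[RHS]/(bd g D w B).
under eq_bigr => j _ do rewrite !mxE.
rewrite -(big_enum_val (fun A => w A * incidence A B)).
rewrite /incidence; under eq_bigr => A _ do rewrite mulr_sumr.
rewrite (exchange_big_dep (fun x => x \notin B)) /=; last first.
  by move=> A x _ /andP[].
rewrite [RHS]big_mkcondr; apply: eq_bigr => x xB; case: ifPn => xBD.
  rewrite (big_pred1 (x |: B)) => [|A]; first by rewrite scalerAr.
  rewrite /= inE xB; case: (A =P x |: B) => [->|]; last by rewrite !andbF.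
  by rewrite xBD cardsU1 xB Bi /= eqxx.
rewrite big1 // => A /and3P[]; rewrite inE => /andP[AD _] _ /eqP AE.
by rewrite -AE AD in xBD.
Qed.

Lemma chain_gaug w : (chain 0 w *m gaug simplicial_seq) ord0 ord0 = w set0.
Proof.
rewrite mxE; under eq_bigr => j _ do rewrite !mxE mulr1.
rewrite -(big_enum_val w) (big_pred1 set0) // => A /=.
by rewrite inE cards_eq0; case: eqP => [->|]; rewrite ?D0 ?andbF.
Qed.

Lemma bd_set0_ideal w : bd g D w set0 \in I.
Proof.
apply/IP => m; rewrite -[_ \in _]negbK -mcoeff_eq0.
have -> : m = (m - lcm set0)%MM by rewrite mlcms0 subm0.
rewrite bd_slice; last by rewrite mlcms0; apply/mnm_lepP => i; rewrite mnm0E.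
rewrite mlcms0 subm0; apply: contraNP => /forallNP noX.
rewrite big1 // => x _; rewrite /slice mlcmsU.
by case: ifP; rewrite ?mulr0 // => /andP[/noX].
Qed.

Lemma simplicial_free_resolution : free_resolution I simplicial_seq.
Proof.
split=> [p|v|i v].
- exists (chain 0 (fun=> p)); rewrite chain_gaug subrr.
  by apply/IP => m; rewrite msupp0.
- rewrite -(chain_coefK v) chain_gaug; split=> [/IP vI|[w]].
    have [||w wP] := @bd_exact K n s g D D_down (chain_coef v) 0 D_cone.
    + by [].
    + move=> B m _ /eqP; rewrite cards_eq0 => /eqP-> /vI [x xm].
      by exists x; apply: lepm_trans xm (lem_addr _ _).
    exists (chain 1 w); rewrite chain_gdiff; apply/rowP => k; rewrite !mxE.
    by have [BD B0] := cellsP k; rewrite wP.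
  rewrite -(chain_coefK w) chain_gdiff => vw.
  suff -> : chain_coef v set0 = bd g D (chain_coef w) set0.
    exact: bd_set0_ideal.
  by rewrite -!chain_gaug vw.
rewrite -(chain_coefK v) chain_gdiff; split=> [v0|[w]]; last first.
  rewrite -(chain_coefK w) !chain_gdiff => vw; apply/rowP => k; rewrite !mxE.
  have [BD Bi] := cellsP k; set B := enum_val k in BD Bi *.
  rewrite -[RHS](bd_bd g D_down (chain_coef w) B); apply: eq_bigr => x.
  case/andP => xB xBD; congr (_ *: (_ * _)).
  have xBc : x |: B \in cells i.+1 by rewrite inE xBD cardsU1 xB Bi eqxx.
  move/rowP: vw => /(_ (enum_rank_in xBc (x |: B))).
  by rewrite !mxE enum_rankK_in.
have [||w wP] := @bd_exact K n s g D D_down (chain_coef v) i.+1 D_cone.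
- move=> B BD [Bi]; have Bc : B \in cells i by rewrite inE BD Bi eqxx.
  move/rowP: v0 => /(_ (enum_rank_in Bc B)).
  by rewrite !mxE enum_rankK_in.
- move=> B m _ Bi _; have /card_gt0P[x xB] : (0 < #|B|)%N by rewrite Bi.
  exists x; apply: lepm_trans (lem_addl _ _).
  by have /mlcms_leP := lepm_refl (lcm B); apply.
exists (chain i.+2 w); rewrite chain_gdiff; apply/rowP => k; rewrite !mxE.
by have [BD Bi] := cellsP k; rewrite wP.
Qed.

Lemma simplicial_graded_maps : graded_maps simplicial_seq.
Proof.
split=> [i j k|j] /=.
  rewrite mxE; set A := enum_val j; set B := enum_val k.
  have [BA|BA] := boolP (B \subset A); last first.
    left; rewrite /incidence big1 // => x /andP[_ /eqP AE].
    by case/negP: BA; rewrite AE subsetUr.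
  right; exists (mdeg (lcm A - lcm B)).
    have -> : mdeg (lcm A) = (mdeg (lcm A - lcm B) + mdeg (lcm B))%N.
      by rewrite -mdegD submK //; apply: mlcmsS.
    by rewrite PoszD addrK.
  by apply: rpred_sum => x _; apply: rpredZ; rewrite dhomogX.
right; exists 0%N; last by rewrite mxE dhomog1.
have [_ /eqP] := cellsP j; rewrite cards_eq0 => /eqP->.
by rewrite mlcms0 mdeg0.
Qed.

Lemma monomial_irrelevant (c : K) (m : 'X_{1..n}) :
  m != 0%MM -> c *: 'X_[m] \in @irrelevant_ideal K n.
Proof.
move=> m0; have [i mi] : exists i, m i != 0%N.
  apply: contraNP m0 => /forallNP m0; apply/eqP/mnmP => i.
  by rewrite mnm0E; apply/eqP/negPn/negP/m0.
apply/asboolP; exists 1%N, (fun=> c *: 'X_[m - U_(i)]), (fun=> 'X_i).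
split=> [_|]; first by apply/existsP; exists i.
by rewrite big_ord1 -scalerAl -mpolyXD submK // lep1mP.
Qed.

Lemma simplicial_minimal_resolution :
  minimal_graded_resolution I simplicial_seq.
Proof.
split; [exact: simplicial_graded_maps | exact: simplicial_free_resolution |].
move=> i j k; rewrite mxE; apply: ideal_gen_sum => x /andP[xB /eqP AE].
apply: monomial_irrelevant; rewrite AE.
have [AD _] := cellsP j.
have := D_min AD (x := x); rewrite AE setU11 setU1K // => /(_ isT).
apply: contraNneq => /mnmP AB0; apply/mnm_lepP => a.
have := AB0 a; rewrite mnmBE mnm0E => /eqP; rewrite subn_eq0.
by apply: leq_trans; rewrite mnmE (bigmax_sup x) ?setU11.
Qed.

Lemma betti_simplicial (S : {pred R}) i :
  I =i ideal_gen S -> betti I i = #|cells i|.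
Proof. by move=> IS; rewrite (betti_eq _ IS simplicial_minimal_resolution). Qed.

End SimplicialResolutionIsMinimal.

(** * Monomial ideals and polarization *)

Section MonomialIdealMembership.
Variables (K : fieldType) (n : nat).
Local Notation R := {mpoly K[n]}.
Implicit Types (A B : {pred 'X_{1..n}}) (p : R) (I : {pred R}).

Lemma mem_ideal_gen (S : {pred R}) p : p \in S -> p \in ideal_gen S.
Proof.
move=> pS; apply/asboolP; exists 1%N, (fun=> 1), (fun=> p).
by split=> //; rewrite big_ord1 mul1r.
Qed.

Lemma mon_idealP A p :
  p \in mon_ideal K A <->
  forall m, m \in msupp p -> exists2 a, a \in A & (a <= m)%MM.
Proof.
split=> [/asboolP[k [c [t [tA ->]]]] m|pA].
  rewrite -[_ \in _]negbK -mcoeff_eq0; apply: contraNP => noA.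
  rewrite raddf_sum big1 //= => i _; have /asboolP[a aA ->] := tA i.
  by rewrite mcoeffMX_if; case: ifP => // am; case: noA; exists a.
have [_ _ SM] := ideal_gen_closed
  [pred p : R | `[< exists2 m, m \in A & p = 'X_[m] >]].
rewrite [p]mpolyE big_seq; apply: ideal_gen_sum => m /pA[a aA am].
rewrite -(submK am) mpolyXD scalerAl; apply/SM/mem_ideal_gen/asboolP.
by exists a.
Qed.

Lemma eq_mon_ideal A B : A =i B -> mon_ideal K A =i mon_ideal K B.
Proof.
move=> AB p; apply/idP/idP => /mon_idealP pA; apply/mon_idealP => m /pA[a aA].
  by exists a; rewrite // -AB.
by exists a; rewrite // AB.
Qed.

Lemma mon_ideal_dvd A B a : mon_ideal K A =i mon_ideal K B ->
  a \in A -> exists2 b, b \in B & (b <= a)%MM.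
Proof.
move=> AB aA; have /mon_idealP : 'X_[a] \in mon_ideal K B.
  rewrite -AB; apply/mon_idealP => m; rewrite msuppX inE => /eqP->.
  by exists a; rewrite ?lepm_refl.
by apply; rewrite msuppX inE.
Qed.

Lemma min_mon_gens_antichain I (G : {fset 'X_{1..n}}) a b :
  min_mon_gens I G -> a \in G -> b \in G -> (a <= b)%MM -> a = b.
Proof.
move=> [IG Gmin] aG bG ab; apply/eqP/negPn/negP => neq_ab.
have /fsetP/(_ b) : (G `\ b)%fset = G.
  apply: Gmin => [|p]; first exact: fsubD1set.
  rewrite IG; apply/idP/idP => /mon_idealP pG; apply/mon_idealP => m /pG[c].
    have [-> _ bm|cb cG cm] := eqVneq c b.
      exists a; first by rewrite !inE neq_ab.
      exact: lepm_trans ab bm.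
    by exists c; rewrite // !inE cb.
  by rewrite !inE => /andP[_ cG] cm; exists c.
by rewrite !inE eqxx bG.
Qed.

End MonomialIdealMembership.

Lemma lepm_anti n (a b : 'X_{1..n}) : (a <= b)%MM -> (b <= a)%MM -> a = b.
Proof.
move=> /mnm_lepP ab /mnm_lepP ba; apply/mnmP => i.
by apply/eqP; rewrite eqn_leq ab ba.
Qed.

Section Polarization.
Variables (n d : nat).
Implicit Types (a b m : 'X_{1..n}).

Lemma polarize_monE m (i : 'I_n) (j : 'I_d) :
  polarize_mon d m (mxvec_index i j) = (j < m i)%N.
Proof.
have idx_inj (i' : 'I_n) (j' : 'I_d) :
    (mxvec_index i' j' == mxvec_index i j) = (i' == i) && (j' == j).
  rewrite /mxvec_index (inj_eq (@cast_ord_inj _ _ _)).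
  by rewrite (inj_eq enum_rank_inj) xpair_eqE.
rewrite mnm_sumE (bigD1 i) //= [X in (_ + X)%N]big1 => [|i' i'i]; last first.
  by rewrite mnm_sumE big1 // => j' _; rewrite mnm1E idx_inj (negbTE i'i).
rewrite addn0 mnm_sumE big_mkcond (bigD1 j) //= big1 => [|j' j'j]; last first.
  by case: ifP => // _; rewrite mnm1E idx_inj eqxx (negbTE j'j).
by rewrite addn0 mnm1E eqxx; case: ifP.
Qed.

Lemma polarize_mon_le a b : (forall i, a i <= d)%N ->
  (polarize_mon d a <= polarize_mon d b)%MM -> (a <= b)%MM.
Proof.
move=> ad /mnm_lepP ab; apply/mnm_lepP => i.
case: (posnP (a i)) => [->//|ai]; have jd : ((a i).-1 < d)%N by rewrite prednK.
have := ab (mxvec_index i (Ordinal jd)).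
by rewrite !polarize_monE /= prednK // leqnn lt0b.
Qed.

(** Two antichains of monomials generating the same ideal coincide.  As
polarization reflects divisibility, it maps the minimal generators of [I]
to an antichain, which is therefore the given antichain [L]. *)
Lemma polarization_gens (K : fieldType) (I : {pred {mpoly K[n]}})
    (G : {fset 'X_{1..n}}) s (L : 'I_s -> 'X_{1..n * d}) :
  min_mon_gens I G -> (forall m, m \in G -> forall i, (m i <= d)%N) ->
  polarization K d G =i mon_ideal K (mem [seq L x | x : 'I_s]) ->
  (forall x y, (L x <= L y)%MM -> x = y) ->
  exists2 g : 'I_s -> 'X_{1..n},
    I =i mon_ideal K (mem [seq g x | x : 'I_s])
    & forall x, g x \in G /\ polarize_mon d (g x) = L x.
Proof.
move=> GI Gd GL Lanti.
have /choice[g gP] x : exists m, m \in G /\ polarize_mon d m = L x.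
  have [|l] := mon_ideal_dvd (fsym GL) (a := L x).
    by apply/imageP; exists x.
  move=> /asboolP[m mG ->{l}] mx; exists m; split=> //.
  have [|l] := mon_ideal_dvd GL (a := polarize_mon d m).
    by apply/asboolP; exists m.
  move=> /imageP[y _ ->] ym; have yx := Lanti _ _ (lepm_trans ym mx).
  by apply: lepm_anti => //; rewrite -yx.
exists g => // p.
rewrite (proj1 GI p); apply: eq_mon_ideal => m.
apply/idP/imageP => [mG|[x _ ->]]; last by have [] := gP x.
have [|l] := mon_ideal_dvd GL (a := polarize_mon d m).
  by apply/asboolP; exists m.
move=> /imageP[x _ ->]; have [gG <-] := gP x => gm.
exists x => //; apply/esym/(min_mon_gens_antichain GI) => //.
exact: polarize_mon_le (Gd _ gG) gm.
Qed.

End Polarization.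

(** Coprimality enters through these variables: they tell the blocks apart, and
hence reduce divisibility of products of blocks to inclusion. *)
Lemma private_variable N (T : eqType) (F : T -> 'X_{1..N}) (ts : seq T) (t : T) :
  uniq ts -> admissible [seq F t | t <- ts] -> t \in ts ->
  exists k, forall t', t' \in ts -> (F t' k != 0%N) = (t' == t).
Proof.
move=> uts /and3P[_ /allP Fnz]; rewrite pairwise_map => /(pairwiseP t) Fco tts.
have [k Fk] : exists k, F t k != 0%N.
  apply: contraNP (Fnz _ (map_f F tts)) => /forallNP F0.
  by apply/eqP/mnmP => i; rewrite mnm0E; apply/eqP/negPn/negP/F0.
exists k => t' tts'; have [->//|tt'] := eqVneq t' t.
suff : (F t' k == 0%N) || (F t k == 0%N) by rewrite (negbTE Fk) orbF => ->.
have ineq : index t' ts != index t ts.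
  by apply: contra tt' => /eqP E; rewrite -(nth_index t tts') E nth_index.
have idx u : u \in ts -> (index u ts < size ts)%N by rewrite index_mem.
case: ltngtP ineq => // lt _.
  have := Fco _ _ (idx _ tts') (idx _ tts) lt.
  by rewrite /relpre/= !nth_index // => /forallP.
have := Fco _ _ (idx _ tts) (idx _ tts') lt.
by rewrite /relpre/= !nth_index // => /forallP/(_ k); rewrite orbC.
Qed.

Lemma card_supersets (X : finType) (S : {set X}) (i : nat) :
  #|[set A : {set X} | (S \subset A) && (#|A| == i)]|
  = ((#|S| <= i) * 'C(#|X| - #|S|, i - #|S|))%N.
Proof.
have [Si|iS] := leqP #|S| i; last first.
  rewrite mul0n; apply: eq_card0 => A; rewrite !inE; apply/negP => /andP[SA /eqP Ai].
  by move: iS; rewrite -Ai ltnNge subset_leq_card.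
have -> : (#|X| - #|S|)%N = #|~: S| by rewrite [RHS]cardsCs setCK.
rewrite mul1n -cards_draws.
rewrite -[RHS](card_in_imset (f := fun B => S :|: B)) => [|B B'].
  apply: eq_card => A; rewrite inE.
  apply/idP/imsetP => [/andP[SA /eqP Ai]|[B]].
    exists (A :\: S); last first.
      apply/setP => y; rewrite !inE.
      by case: (boolP (y \in S)) => [/(subsetP SA)->|].
    by rewrite inE subsetDr -Ai -(cardsID S A) (setIidPr SA) addKn eqxx.
  rewrite inE => /andP[BS /eqP Bi] ->; rewrite subsetUl cardsU Bi.
  suff -> : S :&: B = set0 by rewrite cards0 subn0 subnKC ?eqxx.
  by apply/disjoint_setI0; rewrite disjoint_sym disjoints_subset.
rewrite !inE => /andP[BS _] /andP[BS' _] /(congr1 (fun C => C :\: S)).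
rewrite !setDUl setDv !set0U => E.
have D0 (C : {set X}) : C \subset ~: S -> C :\: S = C.
  by move=> CS; apply/setDidPl; rewrite disjoints_subset.
by rewrite -(D0 B) // -(D0 B').
Qed.

(** The generators of the polarized ideal are products of blocks [F t]; the
sequence [b x] lists the blocks of the generator [x]. *)
Section BlockPatterns.
Variables (K : fieldType) (n d : nat) (I : {pred {mpoly K[n]}}).
Variables (G : {fset 'X_{1..n}}) (s : nat) (T : eqType).
Variables (F : T -> 'X_{1..n * d}) (ts : seq T) (b : 'I_s.+1 -> seq T).
Implicit Types (x y c : 'I_s.+1) (A V S : {set 'I_s.+1}).

Hypothesis GI : min_mon_gens I G.
Hypothesis Gd : forall m, m \in G -> forall i, (m i <= d)%N.
Hypothesis ts_uniq : uniq ts.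
Hypothesis F_adm : admissible [seq F t | t <- ts].
Hypothesis b_ts : forall x, {subset b x <= ts}.
Hypothesis polG : polarization K d G =i
  mon_ideal K (mem [seq (\sum_(t <- b x) F t)%MM | x : 'I_s.+1]).

(** The generator [x] then divides the lcm of the generators in [V]. *)
Definition covered V x := forall t, t \in b x -> exists2 y, y \in V & t \in b y.

(** The generator [x] then does not divide the lcm of the other ones in [A]. *)
Definition has_private_block A x :=
  exists2 t, t \in b x & forall y, y \in A -> y != x -> t \notin b y.

Let L x := (\sum_(t <- b x) F t)%MM.

Lemma block_sum_neq0 x k : (L x k != 0%N) = has (fun t => F t k != 0%N) (b x).
Proof.
rewrite mnm_sumE; elim: (b x) => [|t r IH]; first by rewrite big_nil.
by rewrite big_cons addn_eq0 negb_and IH.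
Qed.

Lemma block_variable t : t \in ts ->
  exists k, forall x, (L x k != 0%N) = (t \in b x).
Proof.
move=> tts; have [k kP] := private_variable ts_uniq F_adm tts.
exists k => x; rewrite block_sum_neq0; apply/hasP/idP => [[t' t'b]|tb].
  by rewrite kP ?(b_ts t'b) // => /eqP<-.
by exists t; rewrite ?kP.
Qed.

(** In the cone condition [V] stands for the set of all generators dividing some
monomial; such a set contains every generator that it covers. *)
Lemma betti_blocks (D : {set {set 'I_s.+1}}) i :
  (forall x y, {subset b x <= b y} -> x = y) ->
  (forall A B : {set _}, A \subset B -> B \in D -> A \in D) ->
  set0 \in D ->
  (forall A x, A \in D -> x \in A -> has_private_block A x) ->
  (forall V x, x \in V -> (forall y, covered V y -> y \in V) ->
    exists2 c, c \in V & forall A, A \subset V -> A \in D -> c |: A \in D) ->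
  betti I i = #|cells D i|.
Proof.
move=> b_anti D_down D0 D_priv D_cone.
have [x y /mnm_lepP Lxy|g IE gP] := polarization_gens GI Gd polG.
  apply: b_anti => t tx; have [k kP] := block_variable (b_ts tx).
  by rewrite -kP -lt0n; apply: leq_trans (Lxy k); rewrite lt0n kP.
have gL x := (gP x).2.
have gLE x i' j : (L x (mxvec_index i' j) != 0%N) = (j < g x i')%N.
  by rewrite /L -gL polarize_monE eqb0 negbK.
apply: (@betti_simplicial K n s.+1 g D _ _ _ _ I _ _ i IE) => //.
- move=> a; pose V := [set x | (g x <= a)%MM].
  have [[x xa]|no_x] := pselect (exists x, (g x <= a)%MM); last first.
    by exists ord0 => xa; case: no_x.
  (* The last variable over [i'] of the polarization of [y] lies in a block of [y].
     This block occurs in some [z] in [V], whose exponent is thus as large. *)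
  have [|y yV|c] := D_cone V x; first by rewrite inE.
    rewrite inE; apply/mnm_lepP => i'; case: (posnP (g y i')) => [->//|gy].
    have jd : ((g y i').-1 < d)%N.
      by rewrite prednK //; apply: Gd (gP y).1 _.
    have := gLE y i' (Ordinal jd); rewrite /= prednK // leqnn block_sum_neq0.
    case/hasP => t tb Ft; have [z] := yV t tb; rewrite inE => /mnm_lepP za tz.
    apply: leq_trans (za i').
    have := gLE z i' (Ordinal jd); rewrite /= prednK // => <-.
    by rewrite block_sum_neq0; apply/hasP; exists t.
  rewrite inE => ca cP; exists c => _; split=> // A /mlcms_leP Aa AD.
  by apply: cP => //; apply/subsetP => z /Aa; rewrite inE.
- move=> A x AD xA; have [t tx tP] := D_priv A x AD xA.
  have [k kP] := block_variable (b_ts tx).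
  move: (kP); case/mxvec_indexP: k {kP} => i' j kP.
  apply/mnm_lepP => /(_ i'); apply/negP; rewrite -ltnNge.
  have := kP x; rewrite gLE tx => /idP; apply: leq_ltn_trans.
  rewrite mnmE; apply/bigmax_leqP => y; rewrite !inE => /andP[yx yA].
  by rewrite leqNgt; have := kP y; rewrite gLE (negbTE (tP y yA yx)) => ->.
move=> p; rewrite IE; split=> [/mon_idealP pI m /pI[a /imageP[x _ ->]]|pI].
  by exists x.
apply/mon_idealP => m /pI[x xm]; exists (g x) => //.
by apply/imageP; exists x.
Qed.

(** Here the Taylor resolution is minimal. *)
Lemma betti_private_blocks i :
  (forall x, has_private_block setT x) -> betti I i = 'C(s.+1, i).
Proof.
move=> priv; rewrite (@betti_blocks setT) ?inE //; last 2 first.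
- by move=> A x _ _; have [t tx tP] := priv x; exists t => // y _; apply/tP/in_setT.
- by move=> V x xV _; exists x => // *; rewrite inE.
- have := card_draws 'I_s.+1 i; rewrite card_ord => <-.
  by apply: eq_card => A; rewrite !inE.
- move=> x y xy; have [t tx tP] := priv x; apply/esym/eqP.
  by apply: contraTT (xy t tx) => /tP; apply; rewrite inE.
by move=> *; rewrite inE.
Qed.

(** The complex consists of the sets that do not contain [S].  Its restriction to
the divisors of a monomial is a simplex or a cone with apex [w]. *)
Lemma betti_redundant_block S w i :
  (forall x y, {subset b x <= b y} -> x = y) ->
  S != set0 -> w \notin S -> covered S w ->
  (forall A x, ~~ (S \subset A) -> x \in A -> has_private_block A x) ->
  (betti I i + (#|S| <= i) * 'C(s.+1 - #|S|, i - #|S|))%N = 'C(s.+1, i).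
Proof.
move=> b_anti S0 wS Sw priv; pose D := [set A : {set 'I_s.+1} | ~~ (S \subset A)].
rewrite (betti_blocks (D := D) i b_anti).
- have := card_supersets S i; rewrite card_ord => <-.
  have := card_draws 'I_s.+1 i; rewrite card_ord => <-.
  rewrite -(cardsID [set A : {set 'I_s.+1} | S \subset A]
    [set A : {set 'I_s.+1} | #|A| == i]).
  by rewrite addnC; congr addn; apply: eq_card => A; rewrite !inE 1?andbC.
- by move=> A B AB; rewrite !inE; apply: contra => /subset_trans; apply.
- by rewrite inE subset0.
- by move=> A x; rewrite inE; apply: priv.
move=> V x xV Vcl; have [SV|SV] := boolP (S \subset V); last first.
  exists x => // A AV _; rewrite inE; apply: contra SV => /subset_trans; apply.
  by rewrite subUset sub1set xV.
exists w => [|A AV]; last first.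
  rewrite !inE; apply: contra => /subsetP SA; apply/subsetP => y yS.
  by have := SA y yS; rewrite !inE => /predU1P[yw|//]; rewrite -yw yS in wS.
by apply: Vcl => t /Sw[y yS ty]; exists y => //; apply: (subsetP SV).
Qed.

End BlockPatterns.

(** * The forms of the polarized ideal *)

Section Forms.
Local Open Scope nat_scope.
Variables (K : fieldType) (n d q : nat) (I : {pred {mpoly K[n]}}).
Variable G : {fset 'X_{1..n}}.
Local Notation T := (nat + nat)%type.
Implicit Types (u v : nat -> 'X_{1..n * d}) (e : seq nat).

Hypothesis GI : min_mon_gens I G.
Hypothesis Gd : forall m, m \in G -> forall i, (m i <= d).

(** The block $u_i$ is encoded as [inl i] and the block $v_j$ as [inr j]. *)
Definition letter u v (t : T) := match t with inl i => u i | inr j => v j end.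

Definition letters (su sv : seq nat) : seq T := map inl su ++ map inr sv.

Lemma mem_inl i su sv : (inl i \in letters su sv) = (i \in su).
Proof.
rewrite mem_cat (mem_map (@inl_inj _ _)) orbC.
by case: mapP => // -[j _].
Qed.

Lemma mem_inr i su sv : (inr i \in letters su sv) = (i \in sv).
Proof.
by rewrite mem_cat (mem_map (@inr_inj _ _)); case: mapP => // -[j _].
Qed.

Lemma letters_uniq su sv : uniq su -> uniq sv -> uniq (letters su sv).
Proof.
move=> usu usv; rewrite cat_uniq !map_inj_uniq //; try by move=> ? ? [].
rewrite usu usv andbT; apply/hasPn => _ /mapP[j _ ->].
by apply/mapP => -[].
Qed.

Lemma map_letters u v su sv :
  map (letter u v) (letters su sv) = map u su ++ map v sv.
Proof. by rewrite map_cat -!map_comp. Qed.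

Lemma sum_letters u v su sv :
  (\sum_(t <- letters su sv) letter u v t
   = \sum_(i <- su) u i + \sum_(j <- sv) v j)%MM.
Proof. by rewrite big_cat !big_map. Qed.

Lemma image_ord (S : Type) (f : nat -> S) (m : nat) :
  [seq f x | x : 'I_m] = [seq f x | x <- iota 0 m].
Proof. by rewrite -val_enum_ord -map_comp. Qed.

Section StarForms.
Variables (r : nat) (e : seq nat).
Hypothesis r_bounds : (2 <= r <= q).

(** The generators of the forms (i) and (ii), numbered from 0; the last one is
$v_1...v_r$ times the $u_i$ with [i] in [e]. *)
Definition star_block (x : nat) : seq T :=
  if (x < r) then letters [:: x.+1] [:: x.+1]
  else if (x < q) then letters [:: x.+1] [::] else letters e (iota 1 r).

Lemma star_inl i (x : nat) :
  (inl i \in star_block x) = if (x < q) then i == x.+1 else i \in e.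
Proof.
have /andP[_ rq] := r_bounds; rewrite /star_block.
case: (ltnP x r) => xr; first by rewrite (leq_trans xr rq) mem_inl inE.
by case: ifP; rewrite mem_inl ?inE.
Qed.

Lemma star_inr j (x : nat) : (inr j \in star_block x)
  = if (x < r) then j == x.+1 else (q <= x) && (0 < j <= r).
Proof.
rewrite /star_block; case: ifP => _; first by rewrite mem_inr inE.
by case: ltnP; rewrite mem_inr // mem_iota add1n ltnS.
Qed.

Lemma star_gens u v :
  [seq (\sum_(t <- star_block x) letter u v t)%MM | x : 'I_q.+1]
  = [seq (u i + v i)%MM | i <- index_iota 1 r.+1] ++ mons u r.+1 q
    ++ [:: (\sum_(i <- e) u i + \sum_(1 <= i < r.+1) v i)%MM].
Proof.
have /andP[_ rq] := r_bounds.
rewrite (image_ord (fun x => (\sum_(t <- star_block x) letter u v t)%MM)).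
rewrite -addn1 -{1}(subnKC rq) -addnA !iotaD add0n !map_cat subnKC //=.
congr (_ ++ (_ ++ [:: _])).
- rewrite /index_iota subn1 /= -[1]addn0 iotaDl -map_comp.
  apply/eq_in_map => x; rewrite mem_iota add0n => /= xr.
  by rewrite /star_block xr sum_letters !big_seq1.
- rewrite /mons /index_iota subSS -add1n iotaDl -map_comp.
  apply/eq_in_map => x; rewrite mem_iota subnKC // => /andP[rx xq] /=.
  by rewrite /star_block ltnNge rx xq sum_letters big_seq1 big_nil addm0.
by rewrite /star_block ltnNge rq ltnn /= sum_letters /index_iota subn1.
Qed.

End StarForms.

(** Every generator but the last one has its own $u_i$.  The last one is covered by
the first [r]; in a set missing one of these, say the one with $v_j$, the block
$v_j$ is private to the last generator. *)
Lemma betti_form1 r i : (2 <= r <= q) -> form1 q r (polarization K d G) ->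
  (betti I i + (r <= i) * 'C(q.+1 - r, i - r)) = 'C(q.+1, i).
Proof.
move=> rq [u [v [adm pol]]]; have /andP[r2 r_q] := rq.
pose S := [set x : 'I_q.+1 | (x < r)].
have cardS : #|S| = r.
  have rq1 : (r <= q.+1) by apply: leqW.
  by rewrite cardsE -sum1_card (big_ord_narrow rq1) sum1_card card_ord.
have ord_q (x : 'I_q.+1) : (x < q) = false -> x = ord_max.
  move=> /negbT; rewrite -leqNgt => qx; apply/val_inj/eqP.
  by rewrite eqn_leq qx -ltnS ltn_ord.
have qr : (q < r) = false by rewrite ltnNge r_q.
rewrite -{1 2 3}cardS.
apply: (@betti_redundant_block K n d I G q T (letter u v)
          (letters (iota 1 q) (iota 1 r)) (fun x => star_block r [::] x)
          GI Gd _ _ _ _ S ord_max).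
- by apply: letters_uniq; apply: iota_uniq.
- by move: adm; rewrite map_letters /mons /index_iota !subn1.
- move=> x [j|j].
    rewrite (star_inl _ rq) mem_inl mem_iota; case: ifP => // xq /eqP->.
    by rewrite add1n ltnS.
  rewrite star_inr mem_inr mem_iota add1n ltnS; case: ifP => [xr /eqP->//|_].
  by case/andP.
- move=> p; rewrite pol; apply: eq_mon_ideal => m.
  by rewrite (star_gens [::] rq) big_nil add0m.
- move=> x y xy; have [xq|xq] := boolP (x < q).
    have /xy : inl x.+1 \in star_block r [::] x by rewrite (star_inl _ rq) xq.
    by rewrite (star_inl _ rq); case: ifP => // _ /eqP[E]; apply: val_inj.
  have xE := ord_q _ (negbTE xq); have [yq|yq] := boolP (y < q); last first.
    by rewrite xE (ord_q _ (negbTE yq)).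
  have x_inr j : (0 < j <= r) -> inr j \in star_block r [::] x.
    by rewrite star_inr xE /= qr leqnn.
  have /xy := x_inr 1 (ltnW r2); have /xy := x_inr 2%N r2.
  rewrite !star_inr; case: ifP => _; last by rewrite leqNgt yq.
  by move=> /eqP<-.
- by rewrite -card_gt0 cardS; apply: ltnW.
- by rewrite inE /= qr.
- move=> [j|j]; first by rewrite (star_inl _ rq) ltnn.
  rewrite star_inr /= qr leqnn /= => /andP[j0 jr].
  have jq : (j.-1 < q.+1) by rewrite prednK // leqW // (leq_trans jr).
  exists (Ordinal jq); first by rewrite inE /= prednK.
  by rewrite star_inr /= prednK // jr.
move=> A x SA xA; have [xq|xq] := boolP (x < q).
  exists (inl x.+1) => [|y _ yx]; first by rewrite (star_inl _ rq) xq.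
  rewrite (star_inl _ rq); case: ifP => // _.
  by rewrite eqSS eq_sym.
have {xq} xE := ord_q _ (negbTE xq).
have [j jS jA] := subsetPn SA; rewrite inE in jS.
exists (inr j.+1) => [|y yA yx]; first by rewrite star_inr xE /= qr leqnn.
rewrite star_inr eqSS; case: ifP => [_|_].
  by apply: contraNneq jA => /val_inj->.
have [yq|yq] := boolP (y < q); first by rewrite leqNgt yq.
by rewrite xE (ord_q _ (negbTE yq)) eqxx in yx.
Qed.

Lemma betti_form2 r i : (2 <= r <= q) -> form2 q r (polarization K d G) ->
  betti I i = 'C(q.+1, i).
Proof.
move=> rq [u [v [adm pol]]]; have /andP[r2 r_q] := rq.
apply: (@betti_private_blocks K n d I G q T (letter u v)
          (letters (iota 1 q.+1) (iota 1 r)) (fun x => star_block r [:: q.+1] x)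
          GI Gd).
- by apply: letters_uniq; apply: iota_uniq.
- by move: adm; rewrite map_letters /mons /index_iota !subn1.
- move=> x [j|j].
    rewrite (star_inl _ rq) mem_inl mem_iota inE add1n ltnS.
    by case: ifP => _ /eqP-> //=; apply: ltn_ord.
  rewrite star_inr mem_inr mem_iota add1n ltnS; case: ifP => [xr /eqP->//|_].
  by case/andP.
- move=> p; rewrite pol; apply: eq_mon_ideal => m.
  by rewrite (star_gens [:: q.+1] rq) big_seq1.
move=> x; exists (inl x.+1) => [|y _ yx]; rewrite (star_inl _ rq) inE !eqSS.
  by rewrite eqxx; case: ltnP => // qx; rewrite eqn_leq qx -ltnS ltn_ord.
have yx' : (x == y :> nat) = false by rewrite eq_sym; apply: negbTE.
case: ifP => yq; apply: contraFN yx' => /eqP->; first exact: eqxx.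
by rewrite eqn_leq leqNgt yq /= -ltnS ltn_ord.
Qed.

Section TriangleForms.
Variables e1 e2 e3 : seq nat.

(** The generators of the forms (iii) to (vi), numbered from 0; the first three
are the sides of a triangle with vertices $v_1, v_2, v_3$, each multiplied by some
of the $u_i$. *)
Definition triangle_block (x : nat) : seq T :=
  match x with
  | 0 => letters e1 [:: 1; 2]
  | 1 => letters e2 [:: 1; 3]
  | 2 => letters e3 [:: 2; 3]
  | _ => letters [:: x.+1] [::]
  end.

Definition triangle_letters :=
  letters ((e1 ++ e2 ++ e3) ++ iota 4 (q - 2)) [:: 1; 2; 3].

Lemma triangle_gens u v : 2 <= q ->
  [seq (\sum_(t <- triangle_block x) letter u v t)%MM | x : 'I_q.+1]
  = [:: \sum_(i <- e1) u i + (v 1 + v 2); \sum_(i <- e2) u i + (v 1 + v 3);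
        \sum_(i <- e3) u i + (v 2 + v 3)]%MM ++ mons u 4 q.+1.
Proof.
move=> q2.
rewrite (image_ord (fun x => (\sum_(t <- triangle_block x) letter u v t)%MM)).
have -> : q.+1 = (3 + (q - 2)) by rewrite addSn subnKC.
rewrite iotaD add0n map_cat /=; congr (_ :: _ :: _ :: _).
- by rewrite sum_letters !big_cons big_nil addm0.
- by rewrite sum_letters !big_cons big_nil addm0.
- by rewrite sum_letters !big_cons big_nil addm0.
rewrite /mons /index_iota -addSn addKn -[4]/(1 + 3) iotaDl -map_comp.
apply/eq_in_map => -[|[|[|x]]]; rewrite mem_iota // => _.
by rewrite /= sum_letters big_seq1 big_nil addm0.
Qed.

Lemma triangle_block_letters (x : 'I_q.+1) :
  {subset triangle_block x <= triangle_letters}.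
Proof.
case: x => [[|[|[|x]]] xq] [j|j]; rewrite /= ?mem_inl ?mem_inr ?mem_cat.
all: try by move->; rewrite ?orbT.
all: try by rewrite !inE => /orP[]->; rewrite ?orbT.
  rewrite inE => /eqP->; rewrite mem_iota orbC /=.
  by rewrite -[x.+4]/(4 + x) ltn_add2l ltn_subRL; move: xq; rewrite ltnS => ->.
by [].
Qed.

End TriangleForms.

(** The forms (iii), (iv) and (v).  The third side $v_2v_3$ of the triangle is
covered by the other two.  Among two sides of the triangle, each one has a
private vertex, and a face of the complex does not contain the first two sides. *)
Lemma betti_redundant_edge e1 e2 u v i : 2 <= q ->
  uniq ((e1 ++ e2) ++ iota 4 (q - 2)) ->
  admissible (map u ((e1 ++ e2) ++ iota 4 (q - 2)) ++ map v [:: 1; 2; 3]%N) ->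
  polarization K d G =i mon_ideal K (mem
    ([:: \sum_(i <- e1) u i + (v 1 + v 2); \sum_(i <- e2) u i + (v 1 + v 3);
         v 2 + v 3]%MM ++ mons u 4 q.+1)) ->
  (betti I i + (2 <= i) * 'C(q - 1, i - 2)) = 'C(q.+1, i).
Proof.
move=> q2 u_uniq adm pol.
have q1 : (1 < q.+1) by rewrite ltnW.
pose x0 : 'I_q.+1 := ord0; pose x1 : 'I_q.+1 := Ordinal q1.
pose x2 : 'I_q.+1 := Ordinal (q2 : 2 < q.+1).
have cardS : #|[set x0; x1]| = 2 by rewrite cards2.
have far (x : nat) (y : 'I_q.+1) : (x.+3 < q.+1) ->
    inl x.+4 \in triangle_block e1 e2 [::] y -> y = x.+3 :> nat.
  move=> xq; have /andP[] : (x.+4 \notin e1) && (x.+4 \notin e2).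
    move: u_uniq; rewrite cat_uniq => /and3P[_ /hasPn/(_ x.+4) xe _].
    rewrite -negb_or -mem_cat xe // mem_iota /=.
    by rewrite -[x.+4]/(4 + x) ltn_add2l ltn_subRL.
  case: y => [[|[|[|y]]] yq] /negPf xe1 /negPf xe2; rewrite /= mem_inl ?xe1 ?xe2 //.
  by rewrite inE => /eqP[->].
have -> : (q - 1 = q.+1 - 2) by rewrite subSS.
rewrite -{1 2 3}cardS.
apply: (@betti_redundant_block K n d I G q T (letter u v)
          (triangle_letters e1 e2 [::]) (fun x => triangle_block e1 e2 [::] x)
          GI Gd _ _ _ _ [set x0; x1] x2).
- by apply: letters_uniq => //; rewrite cats0.
- by rewrite map_letters cats0.
- exact: triangle_block_letters.
- move=> p; rewrite pol; apply: eq_mon_ideal => m.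
  by rewrite (triangle_gens _ _ _ _ _ q2) [in RHS]big_nil add0m.
- move=> x y xy; apply: val_inj => /=.
  case: x xy => [[|[|[|x]]] xq] /= xy; last first.
    by apply/esym/(far x) => //; apply: xy; rewrite mem_inl inE.
  + have : inr 2 \in triangle_block e1 e2 [::] y by apply: xy; rewrite mem_inr.
    have : inr 3 \in triangle_block e1 e2 [::] y by apply: xy; rewrite mem_inr.
    by case: y {xy} => [[|[|[|y]]] yq]; rewrite /= !mem_inr.
  + have : inr 1 \in triangle_block e1 e2 [::] y by apply: xy; rewrite mem_inr.
    have : inr 3 \in triangle_block e1 e2 [::] y by apply: xy; rewrite mem_inr.
    by case: y {xy} => [[|[|[|y]]] yq]; rewrite /= !mem_inr.
  + have : inr 1 \in triangle_block e1 e2 [::] y by apply: xy; rewrite mem_inr.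
    have : inr 2 \in triangle_block e1 e2 [::] y by apply: xy; rewrite mem_inr.
    by case: y {xy} => [[|[|[|y]]] yq]; rewrite /= !mem_inr.
- by rewrite -card_gt0 cardS.
- by rewrite !inE.
- move=> [j|j]; first by rewrite mem_inl.
  rewrite mem_inr !inE => /orP[]/eqP->.
    by exists x0; rewrite ?mem_inr // !inE.
  by exists x1; rewrite ?mem_inr // !inE.
move=> A x SA xA.
have S_A : (x0 \notin A) || (x1 \notin A).
  by move: SA; rewrite subUset !sub1set negb_and.
have vertex j (y y' : 'I_q.+1) : y' \notin A ->
    inr j \in triangle_block e1 e2 [::] y ->
    (forall m : nat, inr j \in triangle_block e1 e2 [::] m ->
      m \in [:: y : nat; y' : nat]) ->
    has_private_block (fun x => triangle_block e1 e2 [::] x) A y.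
  move=> y'A jy jP; exists (inr j) => // z zA zy.
  apply/negP => /jP; rewrite !inE -(inj_eq val_inj) /= in zy *.
  by rewrite (negPf zy) => /eqP/val_inj zy'; rewrite -zy' zA in y'A.
case: x xA => [[|[|[|x]]] xq] xA.
- apply: (vertex 1 _ x1) => [||[|[|[|m]]]]; rewrite /= ?mem_inr //.
  by move: S_A; rewrite (_ : x0 = Ordinal xq) ?xA //; apply: val_inj.
- apply: (vertex 1 _ x0) => [||[|[|[|m]]]]; rewrite /= ?mem_inr //.
  by move: S_A; rewrite (_ : x1 = Ordinal xq) ?xA ?orbF //; apply: val_inj.
- case/orP: S_A => [x0A|x1A].
    by apply: (vertex 2 _ x0) => [||[|[|[|m]]]]; rewrite /= ?mem_inr.
  by apply: (vertex 3 _ x1) => [||[|[|[|m]]]]; rewrite /= ?mem_inr.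
exists (inl x.+4) => [|y _ yx]; first by rewrite mem_inl inE.
by apply: contraNN yx => /far yE; apply/eqP/val_inj/yE.
Qed.

Lemma betti_form6 i : 2 <= q -> form6 q (polarization K d G) ->
  betti I i = 'C(q.+1, i).
Proof.
move=> q2 [u [v [adm pol]]].
apply: (@betti_private_blocks K n d I G q T (letter u v)
          (triangle_letters [:: 1] [:: 2] [:: 3])
          (fun x => triangle_block [:: 1] [:: 2] [:: 3] x) GI Gd).
- by apply: letters_uniq => //; apply: (iota_uniq 1 (3 + (q - 2))).
- have uE : index_iota 1 q.+2 = ([:: 1] ++ [:: 2] ++ [:: 3]) ++ iota 4 (q - 2).
    by rewrite /index_iota subn1 /= -{1}(subnKC q2).
  by move: adm; rewrite map_letters /mons uE.
- exact: triangle_block_letters.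
- move=> p; rewrite pol; apply: eq_mon_ideal => m.
  by rewrite (triangle_gens _ _ _ _ _ q2) !big_seq1 !addmA.
move=> x; exists (inl x.+1) => [|y _ yx].
  by case: x => [[|[|[|x]]] xq]; rewrite /= mem_inl inE.
suff -> : (inl x.+1 \in triangle_block [:: 1] [:: 2] [:: 3] y) = (x == y).
  by rewrite eq_sym.
by case: y {yx} => [[|[|[|y]]] yq]; rewrite /= mem_inl inE.
Qed.

Lemma betti_form345 i : 2 <= q ->
  [\/ form3 q (polarization K d G), form4 q (polarization K d G)
    | form5 q (polarization K d G)] ->
  (betti I i + (2 <= i) * 'C(q - 1, i - 2)) = 'C(q.+1, i).
Proof.
move=> q2; have q4 : (q.+2 - 4 = q - 2) by rewrite !subSS.
case=> -[u [v [adm pol]]].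
- apply: (betti_redundant_edge (e1 := [::]) (e2 := [::]) i q2 _ _ _).
  + exact: iota_uniq.
  + by move: adm; rewrite /mons /index_iota q4; apply.
  by move=> p; rewrite pol !big_nil !add0m.
- apply: (betti_redundant_edge (e1 := [:: 1]) (e2 := [::]) i q2 _ _ _).
  + by rewrite /= iota_uniq mem_iota.
  + by move: adm; rewrite /mons /index_iota q4 map_cat -catA; apply.
  by move=> p; rewrite pol big_seq1 big_nil add0m addmA.
apply: (betti_redundant_edge (e1 := [:: 1]) (e2 := [:: 2]) i q2 _ _ _).
- by rewrite /= iota_uniq inE !mem_iota.
- by move: adm; rewrite /mons /index_iota q4 map_cat -catA; apply.
by move=> p; rewrite pol !big_seq1 !addmA.
Qed.

End Forms.

Theorem theorem1p18 (K : fieldType) (n q d : nat) (I : {pred {mpoly K[n]}})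
    (G : {fset 'X_{1..n}})
    (Imon : monomial_ideal I)
    (Iaci : almost_complete_intersection I)
    (Iht : height I q)
    (q_ge2 : (2 <= q)%N)
    (GI : min_mon_gens I G)
    (d_large : forall m, m \in G -> forall i : 'I_n, (m i <= d)%N) :
  [/\ (* (a) *)
      forall r : nat, (2 <= r <= q)%N -> form1 q r (polarization K d G) ->
        (forall i : nat, (i <= r - 1)%N -> betti I i = 'C(q.+1, i)) /\
        (forall i : nat, (r <= i <= q)%N ->
           (betti I i)%:Z = 'C(q.+1, q.+1 - i)%:Z - 'C(q.+1 - r, q.+1 - i)%:Z),
      (* (b) *)
      (exists2 r : nat, (2 <= r <= q)%N & form2 q r (polarization K d G)) \/
        form6 q (polarization K d G) ->
        forall i : nat, (i <= q)%N -> betti I i = 'C(q.+1, i)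
    & (* (c) *)
      [\/ form3 q (polarization K d G), form4 q (polarization K d G)
        | form5 q (polarization K d G)] ->
        forall i : nat, (i <= q)%N ->
          (betti I i)%:Z = 'C(q.+1, i)%:Z - binz (q - 1) (i%:Z - 2)].
Proof.
have d_large' m : m \in G -> forall i, (m i <= d)%N by apply: d_large.
split.
- move=> r rq f1; split=> i ir; have := betti_form1 GI d_large' i rq f1.
    have /andP[r2 _] := rq.
    by rewrite leqNgt -(ltn_predK r2) ltnS -subn1 ir addn0.
  have /andP[ri iq] := ir; have /andP[r2 r_q] := rq.
  rewrite ri mul1n bin_sub ?(leqW iq) //.
  have -> : (q.+1 - i = (q.+1 - r) - (i - r))%N by rewrite -subnDA subnKC.
  rewrite bin_sub ?leq_sub2r ?(leqW iq) // => <-.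
  by rewrite PoszD addrK.
- move=> [[r rq f2]|f6] i _; first exact: (betti_form2 GI d_large' i rq f2).
  exact: (betti_form6 GI d_large' i q_ge2 f6).
move=> f345 i _; have := betti_form345 GI d_large' i q_ge2 f345.
case: i => [|[|i]] <-; rewrite ?mul0n ?addn0 ?subr0 //.
by rewrite mul1n subSS subn1 /= PoszD addrK.
Qed.
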